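(* Let $(\Omega,\mathcal{F},\mathbb{P})$ be a probability space with filtration $\mathcal{F}_0\subset\cdots\subset\mathcal{F}_T=\mathcal{F}$, let $d\in\mathbb{N}$, and for each $t=0,\dots,T-1$ let $(X_t,d_{X_t})$ be an $\mathcal{F}_t$-conditional metric space and $Z_t=L^0_t(\mathbb{R}^d)$. Suppose that for each $t=0,\dots,T-1$, $\Theta_t$ assigns to each $x\in X_t$ a subset $\Theta_t(x)$ of $Z_t$ such that (c1) $\emptyset\neq\Theta_t(x)\subset Z_t$ for all $x\in X_t$; (c2) $\Theta_t\big(\sum_k1_{A_k}x_k\big)=\sum_k1_{A_k}\Theta_t(x_k):=\big\{\sum_k1_{A_k}z_k:z_k\in\Theta_t(x_k)\text{ for all }k\big\}$ for all $(A_k)\in\Pi_{\mathcal{F}_t}$ and every sequence $(x_k)$ in $X_t$; (i) the set $\{(x,z)\in X_t\times L^0_t(\mathbb{R}^d):z\in\Theta_t(x)\}$ is sequentially closed; (ii) for every sequence $(x_n)$ in $X_t$ with $x_n\to x\in X_t$ a.s. there exists $M\in L^0_{t,+}$ such that $d_{L^0_t(\mathbb{R}^d)}(z,0)\le M$ for all $z\in\bigcup_n\Theta_t(x_n)$. Then, for each $t=0,\dots,T-1$, $\Theta_t$ satisfies (c1), (c2) and also: (c3) for every $x\in X_t$ and every sequence $(z_n)$ in $\Theta_t(x)$ there exist $n_1<n_2<\cdots$ with $n_k\in L^0_t(\mathbb{N})$ and $z\in\Theta_t(x)$ such that $z_{n_k}\to z$ a.s.; (c4) for every sequence $(x_n)$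 in $X_t$ with $x_n\to x\in X_t$ a.s. and every sequence $(z_n)$ with $z_n\in\Theta_t(x_n)$ for all $n$, there exist $n_1<n_2<\cdots$ with $n_k\in L^0_t(\mathbb{N})$ and a sequence $(z'_k)$ in $\Theta_t(x)$ such that $d_{L^0_t(\mathbb{R}^d)}(z_{n_k},z'_k)\to0$ a.s.
   Context: Sets in $\mathcal{F}$ are identified if their symmetric difference is null, and functions on $\Omega$ are identified if they coincide a.s.; inequalities between random variables hold a.s. $\mathbb{N}=\{1,2,\dots\}$. For a sub-$\sigma$-algebra $\mathcal{G}$ of $\mathcal{F}$: $\Pi_{\mathcal{G}}$ is the set of countable partitions $(A_k)$ of $\Omega$ with all $A_k\in\mathcal{G}$; $L^0_{\mathcal{G},+}$ and $L^0_{\mathcal{G}}(\mathbb{N})$ are the spaces of $\mathcal{G}$-measurable random variables with values in $[0,\infty)$ and $\mathbb{N}$. The index $\mathcal{F}_t$ is abbreviated by $t$. A $\mathcal{G}$-conditional metric space is a nonempty set $X$ with a function $d:X\times X\to L^0_{\mathcal{G},+}$ such that (1) $d(x,y)=0$ iff $x=y$; (2) $d(x,y)=d(y,x)$; (3) $d(x,z)\le d(x,y)+d(y,z)$; (4) for every sequence $(x_k)$ in $X$ and $(A_k)\in\Pi_{\mathcal{G}}$ there is exactly one $x\in X$ with $1_{A_k}d(x,x_k)=0$ for all $k$, denoted $\sum_k1_{A_k}x_k$. Write $x_n\to x$ a.s. if $d(x,x_n)\to0$ a.s. For $n_k\in L^0_{\mathcal{G}}(\mathbb{N})$, $x_{n_k}:=\sum_{j\in\mathbb{N}}1_{\{n_k=j\}}x_j$.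 A subset $H$ is sequentially closed if it contains every $x$ for which there is a sequence $(x_k)$ in $H$ with $x_k\to x$ a.s. Products carry the maximum of the conditional metrics of the factors. $L^0_t(\mathbb{R}^d)$ is the space of $\mathcal{F}_t$-measurable random vectors with values in $\mathbb{R}^d$, with the $\mathcal{F}_t$-conditional metric $d_{L^0_t(\mathbb{R}^d)}(z,\bar z)=|z-\bar z|$ (pointwise a.s. Euclidean distance). *)

(* Defs.v *)
From HB Require Import structures.
From mathcomp Require Import all_boot all_order all_algebra generic_quotient.
From mathcomp Require Import all_classical all_reals all_analysis.
From mathcomp Require Import measurable_realfun ring lra.

Set Implicit Arguments.
Unset Strict Implicit.
Unset Printing Implicit Defensive.

Import Order.TTheory GRing.Theory Num.Theory.
Import numFieldTopology.Exports numFieldNormedType.Exports.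

Local Open Scope classical_set_scope.
Local Open Scope ring_scope.

Record subSigmaAlgebra disp (Omega : measurableType disp) := SubSigmaAlgebra {
  ssa_sets :> set (set Omega) ;
  ssa_sigma_algebra : sigma_algebra setT ssa_sets ;
  ssa_sub : ssa_sets `<=` measurable }.

Section L0.
Context disp (Omega : measurableType disp) (R : realType).
Variables (P : probability Omega R) (G : subSigmaAlgebra Omega).
Context dV (V : measurableType dV).

(* [g_sigma_algebraType G] is [Omega] equipped with the sigma-algebra
   generated by [G], that is, with [G] itself (lemma [G_measurableE]). *)
Lemma G_measurableE : (G : set (set Omega)).-sigma.-measurable = ssa_sets G.
Proof. exact/measurable_g_measurableTypeE/ssa_sigma_algebra. Qed.

Definition as_eq (f g : {mfun (g_sigma_algebraType G) >-> V}) : bool :=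
  `[< \forall w \ae P, (f : Omega -> V) w = g w >].

Let as_eq_refl : reflexive as_eq.
Proof. by move=> f; apply/asboolP/aeW. Qed.

Let as_eq_sym : symmetric as_eq.
Proof.
by move=> f g; apply/idP/idP => /asboolP h; apply/asboolP; apply: filterS h.
Qed.

Let as_eq_trans : transitive as_eq.
Proof.
move=> f g h /asboolP gf /asboolP fh; apply/asboolP.
by apply: filterS2 gf fh => w -> ->.
Qed.

Canonical as_eq_canonical := EquivRel as_eq as_eq_refl as_eq_sym as_eq_trans.

(* G-measurable maps [Omega -> V], up to P-almost sure equality; an element is
   used as a function through an (arbitrary) representative. *)
Definition L0 : Type := {eq_quot as_eq}%qT.
HB.instance Definition _ := Choice.on L0.
HB.instance Definition _ := EqQuotient.on L0.

Definition fun_of_L0 (f : L0) : Omega -> V :=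
  (repr f : {mfun (g_sigma_algebraType G) >-> V}).
Coercion fun_of_L0 : L0 >-> Funclass.

Definition mkL0 (f : Omega -> V)
    (mf : measurable_fun setT (f : g_sigma_algebraType G -> V)) : L0 :=
  (\pi_L0 (mfun_Sub (mem_set mf)))%qT.

Definition L0_cst (v : V) : L0 := @mkL0 (cst v) (@measurable_cst _ _ _ _ _ _).

Lemma L0_measurable (f : L0) :
  measurable_fun setT (fun_of_L0 f : g_sigma_algebraType G -> V).
Proof. exact: measurable_funPT. Qed.

Lemma L0P (f g : L0) : (\forall w \ae P, f w = g w) <-> f = g.
Proof.
split=> [fg|->]; last exact: aeW.
rewrite -[f]reprK -[g]reprK; apply/eqP; rewrite eqmodE; exact/asboolP.
Qed.

Lemma mkL0E f mf : \forall w \ae P, @mkL0 f mf w = f w.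
Proof.
have : (mfun_Sub (mem_set mf) == repr (@mkL0 f mf) %[mod L0])%qT.
  by rewrite reprK.
by rewrite eqmodE => /asboolP; apply: filterS => w /= ->.
Qed.

End L0.

Section partition.
Context disp (Omega : measurableType disp) (R : realType).
Variables (P : probability Omega R) (G : subSigmaAlgebra Omega).

(* Finite partitions are padded with empty sets. Since sets are identified
   modulo null sets, the blocks are only required to be disjoint and to cover
   [Omega] almost surely. *)
Record partition := Partition {
  blocks :> nat -> set Omega ;
  blocks_measurable : forall k, ssa_sets G (blocks k) ;
  blocks_partition : \forall w \ae P, exists! k, blocks k w }.

Lemma levels_measurable (n : L0 P G nat) j :
  ssa_sets G [set w | n w = j].
Proof.
rewrite -G_measurableE.
by have := @L0_measurable _ _ _ _ _ _ _ n measurableT [set j] I; rewrite setTI.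
Qed.

Lemma levels_partition (n : L0 P G nat) :
  \forall w \ae P, exists! j, [set w | n w = j] w.
Proof. by apply: aeW => w; exists (n w); split. Qed.

Definition levels (n : L0 P G nat) : partition :=
  Partition (levels_measurable n) (levels_partition n).

End partition.

Record condMetricSpace disp (Omega : measurableType disp) (R : realType)
    (P : probability Omega R) (G : subSigmaAlgebra Omega) := CondMetricSpace {
  cms_sort :> Type ;
  cms_inhabited : inhabited cms_sort ;
  cdist : cms_sort -> cms_sort -> L0 P G R ;
  cdist_ge0 : forall x y, \forall w \ae P, 0 <= cdist x y w ;
  cdist_eq0 : forall x y, (\forall w \ae P, cdist x y w = 0) <-> x = y ;
  cdist_sym : forall x y, \forall w \ae P, cdist x y w = cdist y x w ;
  cdist_triangle : forall x y z,
    \forall w \ae P, cdist x z w <= cdist x y w + cdist y z w ;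
  cms_concat : forall (A : partition P G) (x_ : nat -> cms_sort),
    exists! x, forall k,
      \forall w \ae P, \1_(A k) w * cdist x (x_ k) w = 0 }.

Section conditional_metric_space.
Context disp (Omega : measurableType disp) (R : realType).
Variables (P : probability Omega R) (G : subSigmaAlgebra Omega).
Implicit Type X : condMetricSpace P G.

(* the element [\sum_k 1_(A k) x_k] *)
Definition concat X (A : partition P G) (x_ : nat -> X) : X :=
  projT1 (cid (cms_concat A x_)).

(* the element [x_n] for a random index [n]; here and below, sequences are
   indexed from 0 and random indices take values in {0, 1, 2, ...} *)
Definition rand_index X (x_ : nat -> X) (n : L0 P G nat) : X :=
  concat (levels n) x_.

Definition rand_increasing (n_ : nat -> L0 P G nat) : Prop :=
  forall k, \forall w \ae P, (n_ k w < n_ k.+1 w)%N.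

Definition cvg_as X (x_ : nat -> X) (x : X) : Prop :=
  \forall w \ae P, (fun n => cdist x (x_ n) w) @ \oo --> (0 : R).

Definition seq_closed X (H : set X) : Prop :=
  forall (x_ : nat -> X) (x : X), (forall k, H (x_ k)) -> cvg_as x_ x -> H x.

Lemma concatP X (A : partition P G) (x_ : nat -> X) (k : nat) :
  \forall w \ae P, \1_(A k) w * cdist (concat A x_) (x_ k) w = 0.
Proof. by rewrite /concat; case: cid => x [/= + _]; exact. Qed.

Lemma concat_unique X (A : partition P G) (x_ : nat -> X) (x : X) :
  (forall k, \forall w \ae P, \1_(A k) w * cdist x (x_ k) w = 0) ->
  concat A x_ = x.
Proof. by rewrite /concat; case: cid => y [/= _ +]; exact. Qed.

End conditional_metric_space.

Section product.
Context disp (Omega : measurableType disp) (R : realType).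
Variables (P : probability Omega R) (G : subSigmaAlgebra Omega).
Variables (X Y : condMetricSpace P G).

Lemma prod_dist_measurable (u v : X * Y) :
  measurable_fun setT ((fun w => Num.max (cdist u.1 v.1 w) (cdist u.2 v.2 w))
    : g_sigma_algebraType G -> R).
Proof. by apply: measurable_maxr; exact: L0_measurable. Qed.

Definition prod_dist (u v : X * Y) : L0 P G R :=
  mkL0 P (prod_dist_measurable u v).

Lemma prod_distE u v : \forall w \ae P,
  prod_dist u v w = Num.max (cdist u.1 v.1 w) (cdist u.2 v.2 w).
Proof. exact: mkL0E. Qed.

Let prod_inhabited : inhabited (X * Y).
Proof. by case: (cms_inhabited X) (cms_inhabited Y) => x [y]. Qed.

Let prod_dist_ge0 u v : \forall w \ae P, 0 <= prod_dist u v w.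
Proof.
apply: filterS2 (prod_distE u v) (cdist_ge0 u.1 v.1) => w -> h.
by rewrite le_max h.
Qed.

Lemma prod_mul_eq0 (a : Omega -> R) (u v : X * Y) :
  (\forall w \ae P, 0 <= a w) ->
  (\forall w \ae P, a w * prod_dist u v w = 0) <->
  (\forall w \ae P, a w * cdist u.1 v.1 w = 0) /\
  (\forall w \ae P, a w * cdist u.2 v.2 w = 0).
Proof.
move=> a0; split=> [h|[h1 h2]].
  have h' : \forall w \ae P, a w * cdist u.1 v.1 w = 0 /\
                             a w * cdist u.2 v.2 w = 0.
    apply: filterS3 (filterI h a0) (prod_distE u v)
      (filterI (cdist_ge0 u.1 v.1) (cdist_ge0 u.2 v.2)).
    move=> w [aw aw0] duv [d1 d2]; move: aw; rewrite duv maxr_pMr// => aw.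
    by split; apply/eqP; rewrite eq_le (mulr_ge0 aw0)// andbT -aw le_max lexx
      ?orbT.
  by split; apply: filterS h' => w [].
apply: filterS3 (filterI h1 h2) (prod_distE u v) a0 => w [e1 e2] -> aw0.
by rewrite maxr_pMr// e1 e2 maxxx.
Qed.

Let prod_dist_eq0 u v : (\forall w \ae P, prod_dist u v w = 0) <-> u = v.
Proof.
have := @prod_mul_eq0 (cst 1) u v (aeW _ (fun=> ler01)).
have mul1 (f : Omega -> R) : (\forall w \ae P, cst 1 w * f w = 0) <->
    (\forall w \ae P, f w = 0).
  by split; apply: filterS => w; rewrite /= mul1r.
rewrite !mul1 => ->.
split=> [[/cdist_eq0 h1 /cdist_eq0 h2]|->].
  by move: u v h1 h2 => [? ?] [? ?] /= -> ->.
by split; apply/cdist_eq0.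
Qed.

Let prod_dist_sym u v : \forall w \ae P, prod_dist u v w = prod_dist v u w.
Proof.
apply: filterS3 (filterI (prod_distE u v) (prod_distE v u))
  (cdist_sym u.1 v.1) (cdist_sym u.2 v.2) => w [-> ->] -> ->.
by [].
Qed.

Let prod_dist_triangle x y z :
  \forall w \ae P, prod_dist x z w <= prod_dist x y w + prod_dist y z w.
Proof.
apply: filterS3 (filterI (prod_distE x z) (filterI (prod_distE x y)
  (prod_distE y z))) (cdist_triangle x.1 y.1 z.1) (cdist_triangle x.2 y.2 z.2).
move=> w [-> [-> ->]] h1 h2; rewrite ge_max.
by rewrite (le_trans h1) ?(le_trans h2) ?lerD ?le_max ?lexx ?orbT.
Qed.

Let prod_concat (A : partition P G) (x_ : nat -> X * Y) :
  exists! x, forall k, \forall w \ae P, \1_(A k) w * prod_dist x (x_ k) w = 0.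
Proof.
have ind0 k : \forall w \ae P, 0 <= \1_(A k) w :> R by apply: aeW.
exists (concat A (fst \o x_), concat A (snd \o x_)); split=> [k|[x y] xy].
  by apply/prod_mul_eq0 => //; split; exact: concatP.
congr pair; apply: concat_unique => k.
  by have [+ _] := (prod_mul_eq0 (x, y) (x_ k) (ind0 k)).1 (xy k).
by have [_ +] := (prod_mul_eq0 (x, y) (x_ k) (ind0 k)).1 (xy k).
Qed.

Definition prod_cms : condMetricSpace P G :=
  CondMetricSpace prod_inhabited prod_dist_ge0 prod_dist_eq0 prod_dist_sym
    prod_dist_triangle prod_concat.

End product.

Section euclidean.
Context (R : realType) (dim : nat).
Implicit Types x y z : dim.-tuple R.

(* [dim.-tuple R] carries the product Borel sigma-algebra. *)
Definition euclid_dist x y : R :=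
  Num.sqrt (\sum_(i < dim) (tnth x i - tnth y i) ^+ 2).

Lemma euclid_dist_ge0 x y : 0 <= euclid_dist x y.
Proof. exact: sqrtr_ge0. Qed.

Lemma euclid_dist_sym x y : euclid_dist x y = euclid_dist y x.
Proof. by congr Num.sqrt; apply: eq_bigr => i _; rewrite -sqrrN opprB. Qed.

Lemma euclid_dist_eq0 x y : euclid_dist x y = 0 <-> x = y.
Proof.
split=> [/eqP|->]; last first.
  by rewrite /euclid_dist big1 ?sqrtr0// => i _; rewrite subrr expr0n.
rewrite /euclid_dist sqrtr_eq0 => h.
have s0 : \sum_(i < dim) (tnth x i - tnth y i) ^+ 2 = 0.
  by apply/eqP; rewrite eq_le h/= sumr_ge0// => i _; exact: sqr_ge0.
apply: eq_from_tnth => i; apply/eqP; rewrite -subr_eq0 -sqrf_eq0.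
by move/psumr_eq0P : s0 => ->// j _; exact: sqr_ge0.
Qed.

Lemma sum_cauchy_schwarz (a b : 'I_dim -> R) :
  (\sum_i a i * b i) ^+ 2 <= (\sum_i a i ^+ 2) * (\sum_i b i ^+ 2).
Proof.
have : 0 <= \sum_i \sum_j (a i * b j - a j * b i) ^+ 2.
  by apply: sumr_ge0 => i _; apply: sumr_ge0 => j _; exact: sqr_ge0.
have -> : \sum_i \sum_j (a i * b j - a j * b i) ^+ 2 =
    \sum_i \sum_j (a i ^+ 2 * b j ^+ 2) + \sum_i \sum_j (b i ^+ 2 * a j ^+ 2)
    - 2 * \sum_i \sum_j ((a i * b i) * (a j * b j)).
  rewrite mulr_sumr -sumrN -!big_split; apply: eq_bigr => i _ /=.
  rewrite mulr_sumr -sumrN -!big_split; apply: eq_bigr => j _ /=; ring.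
rewrite -!big_distrlr /=; set A := \sum_i _ ^+ 2; set B := \sum_i b i ^+ 2.
set C := \sum_i a i * b i; nra.
Qed.

Lemma euclid_dist_triangle x y z :
  euclid_dist x z <= euclid_dist x y + euclid_dist y z.
Proof.
pose a i := tnth x i - tnth y i; pose b i := tnth y i - tnth z i.
rewrite /euclid_dist -(@ler_pXn2r _ 2%N)// ?nnegrE ?addr_ge0 ?sqrtr_ge0//.
rewrite sqrrD !sqr_sqrtr; do ?by apply: sumr_ge0 => i _; exact: sqr_ge0.
rewrite -sqrtrM; last by apply: sumr_ge0 => i _; exact: sqr_ge0.
rewrite -/(a _); under [in X in _ <= X]eq_bigr do rewrite -/(a _).
under [in X in _ + X *+ 2 + _]eq_bigr do [].
have -> : \sum_(i < dim) (tnth x i - tnth z i) ^+ 2 =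
    \sum_i a i ^+ 2 + \sum_i b i ^+ 2 + (\sum_i a i * b i) *+ 2.
  rewrite -sumrMnl -!big_split; apply: eq_bigr => i _; rewrite /a /b /=; ring.
rewrite [leRHS]addrAC lerD2l lerMn2r /=.
by rewrite (le_trans (ler_norm _))// -sqrtr_sqr ler_wsqrtr// sum_cauchy_schwarz.
Qed.

End euclidean.

Section random_vectors.
Context disp (Omega : measurableType disp) (R : realType).
Variables (P : probability Omega R) (G : subSigmaAlgebra Omega) (dim : nat).
Local Notation Z := (L0 P G (dim.-tuple R)).

Lemma vec_dist_measurable (z z' : Z) :
  measurable_fun setT
    ((fun w => euclid_dist (z w) (z' w)) : g_sigma_algebraType G -> R).
Proof.
have msqrt : measurable_fun setT (Num.sqrt : R -> R).
  by apply: continuous_measurable_fun; exact: sqrt_continuous.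
apply: (measurableT_comp msqrt).
apply: measurable_sum => i.
apply: measurable_funX; apply: measurable_funB.
  apply: (measurableT_comp (measurable_tnth i)); exact: L0_measurable.
apply: (measurableT_comp (measurable_tnth i)); exact: L0_measurable.
Qed.

Definition vec_dist (z z' : Z) : L0 P G R := mkL0 P (vec_dist_measurable z z').

Lemma vec_distE z z' :
  \forall w \ae P, vec_dist z z' w = euclid_dist (z w) (z' w).
Proof. exact: mkL0E. Qed.

Let vec_inhabited : inhabited Z.
Proof.
by constructor; exact: (L0_cst P G ([tuple 0 | _ < dim] : dim.-tuple R)).
Qed.

Let vec_dist_ge0 z z' : \forall w \ae P, 0 <= vec_dist z z' w.
Proof. by apply: filterS (vec_distE z z') => w ->; exact: euclid_dist_ge0. Qed.

Let vec_dist_eq0 z z' : (\forall w \ae P, vec_dist z z' w = 0) <-> z = z'.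
Proof.
split=> [h|->].
  by apply/L0P; apply: filterS2 h (vec_distE z z') => w -> /esym/euclid_dist_eq0.
by apply: filterS (vec_distE z' z') => w ->; apply/euclid_dist_eq0.
Qed.

Let vec_dist_sym z z' : \forall w \ae P, vec_dist z z' w = vec_dist z' z w.
Proof.
by apply: filterS2 (vec_distE z z') (vec_distE z' z) => w -> ->;
  exact: euclid_dist_sym.
Qed.

Let vec_dist_triangle x y z :
  \forall w \ae P, vec_dist x z w <= vec_dist x y w + vec_dist y z w.
Proof.
by apply: filterS3 (vec_distE x z) (vec_distE x y) (vec_distE y z) =>
  w -> -> ->; exact: euclid_dist_triangle.
Qed.

Lemma vec_glue (A : partition P G) (z_ : nat -> Z) :
  exists z : Z, \forall w \ae P, forall k, A k w -> z w = z_ k w.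
Proof.
pose E := \bigcup_k (A k `&` \bigcap_j (if j == k then setT else ~` A j)).
have EP w : E w <-> exists! k, A k w.
  split=> [[k _ [Ak h]]|[k [Ak h]]].
    exists k; split=> // j Aj; apply/eqP; rewrite eq_sym; apply/negPn/negP => jk.
    by have := h j I; rewrite (negbTE jk); exact.
  exists k => //; split=> // j _; case: ifPn => // /eqP jk Aj.
  by apply: jk; rewrite (h j Aj).
have mA k : (G : set (set Omega)).-sigma.-measurable (A k).
  by rewrite G_measurableE; exact: blocks_measurable.
have mE : (G : set (set Omega)).-sigma.-measurable E.
  apply: bigcupT_measurable => k; apply: measurableI => //.
  by apply: bigcapT_measurable => j; case: ifPn => // _; exact: measurableC.
pose idx w := xget 0%N [set k | A k w].
have idxP w k : E w -> A k w -> idx w = k.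
  move=> /EP[j [Aj uj]] Ak; rewrite /idx; case: xgetP => [i _ /= Ai|/(_ k)//].
  by rewrite -(uj _ Ai) -(uj _ Ak).
have idxA w : E w -> A (idx w) w.
  by move=> Ew; have [k [Ak _]] := (EP w).1 Ew; rewrite (idxP w k).
pose f w : dim.-tuple R := if pselect (E w) then z_ (idx w) w else point.
have mf : measurable_fun setT (f : g_sigma_algebraType G -> dim.-tuple R).
  move=> _ B mB; rewrite setTI.
  have -> : f @^-1` B = (\bigcup_k (E `&` A k `&` (z_ k : Omega -> _) @^-1` B))
      `|` (~` E `&` [set w | B point]).
    apply/seteqP; split=> w /=; rewrite /f.
      case: pselect => Ew Bw; [left|by right].
      by exists (idx w) => //; split => //; split => //; exact: idxA.
    case=> [[k _ [[Ew Ak] Bw]]|[nEw Bp]]; case: pselect => // Ew'.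
    by rewrite (idxP w k).
  apply: measurableU.
    apply: bigcupT_measurable => k; apply: measurableI.
      exact: measurableI.
    by rewrite -[X in measurable X]setTI; exact: L0_measurable.
  apply: measurableI; first exact: measurableC.
  have [Bp|nBp] := pselect (B point).
    by rewrite (_ : [set w | _] = setT)// predeqE.
  by rewrite (_ : [set w | _] = set0)// predeqE.
exists (mkL0 P mf).
apply: filterS2 (mkL0E P mf) (blocks_partition A) => w -> /EP Ew k Ak.
by rewrite /f; case: pselect => // Ew'; rewrite (idxP w k).
Qed.

Let vec_concat (A : partition P G) (z_ : nat -> Z) :
  exists! z, forall k, \forall w \ae P, \1_(A k) w * vec_dist z (z_ k) w = 0.
Proof.
have [z zA] := vec_glue A z_.
exists z; split=> [k|y yA].
  apply: filterS2 zA (vec_distE z (z_ k)) => w zw ->.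
  rewrite indicE; case: (boolP (w \in A k)); rewrite ?mul0r// inE => /zw ->.
  by rewrite mul1r; apply/euclid_dist_eq0.
have {}yA : \forall w \ae P, forall k, A k w -> y w = z_ k w.
  apply: ae_foralln => k; apply: filterS2 (yA k) (vec_distE y (z_ k)) => w + e Ak.
  by rewrite e indicE mem_set// mul1r => /euclid_dist_eq0.
apply/L0P; apply: filterS3 (blocks_partition A) zA yA => w [k [Ak _]] zw yw.
by rewrite (zw k Ak) (yw k Ak).
Qed.

Definition L0vec : condMetricSpace P G :=
  CondMetricSpace vec_inhabited vec_dist_ge0 vec_dist_eq0 vec_dist_sym
    vec_dist_triangle vec_concat.

Definition vec0 : L0vec := L0_cst P G ([tuple 0 | _ < dim] : dim.-tuple R).

End random_vectors.

Section conditions.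
Context disp (Omega : measurableType disp) (R : realType).
Variables (P : probability Omega R) (G : subSigmaAlgebra Omega).
Variables (X Z : condMetricSpace P G) (Theta : X -> set Z).

Definition cond_c1 : Prop := forall x, Theta x !=set0.

Definition cond_c2 : Prop := forall (A : partition P G) (x_ : nat -> X),
  Theta (concat A x_) =
  [set concat A z_ | z_ in [set z_ | forall k, Theta (x_ k) (z_ k)]].

Definition cond_c3 : Prop := forall (x : X) (z_ : nat -> Z),
  (forall n, Theta x (z_ n)) ->
  exists (n_ : nat -> L0 P G nat) (z : Z),
    [/\ rand_increasing n_, Theta x z &
        cvg_as (fun k => rand_index z_ (n_ k)) z].

Definition cond_c4 : Prop := forall (x_ : nat -> X) (x : X) (z_ : nat -> Z),
  cvg_as x_ x -> (forall n, Theta (x_ n) (z_ n)) ->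
  exists (n_ : nat -> L0 P G nat) (z'_ : nat -> Z),
    [/\ rand_increasing n_, forall k, Theta x (z'_ k) &
        \forall w \ae P,
          (fun k => cdist (rand_index z_ (n_ k)) (z'_ k) w) @ \oo --> (0 : R)].

Definition closed_graph : Prop :=
  seq_closed ([set u | Theta u.1 u.2] : set (prod_cms X Z)).

End conditions.

Definition locally_bounded disp (Omega : measurableType disp) (R : realType)
    (P : probability Omega R) (G : subSigmaAlgebra Omega) (dim : nat)
    (X : condMetricSpace P G) (Theta : X -> set (L0vec P G dim)) : Prop :=
  forall (x_ : nat -> X) (x : X), cvg_as x_ x ->
  exists2 M : L0 P G R, (\forall w \ae P, 0 <= M w) &
    forall z, (\bigcup_n Theta (x_ n)) z ->
      \forall w \ae P, cdist z (vec0 P G dim) w <= M w.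

(* Main.v *)
(* The heart of the matter is a conditional Bolzano-Weierstrass theorem: a
   sequence of random vectors bounded by a random variable has an a.s.
   convergent subsequence along measurable random indices. For each w, the terms are coded
   by their cells in finer and finer grids, one keeps at each level the least
   code taken infinitely often along the indices retained so far, and the
   subsequence picks at step k the first new index that agrees with the first k
   codes; all these choices are minima over N of measurable conditions, hence
   measurable. If x_n -> x and z_n is in Theta(x_n), then (ii) provides
   z_(n_k) -> z along random indices n_k, (c2) gives
   z_(n_k) in Theta(x_(n_k)), and since x_(n_k) -> x the closed graph yields
   z in Theta(x). Then (c3) is the case of a constant sequence (x_n), and (c4)
   holds with z'_k = z. *)
Require Import Defs.
From mathcomp Require Import all_boot all_order all_algebra.
From mathcomp Require Import all_classical all_reals all_analysis.
From mathcomp Require Import measurable_realfun lra.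

Set Implicit Arguments.
Unset Strict Implicit.
Unset Printing Implicit Defensive.

Import Order.TTheory GRing.Theory Num.Theory.
Import numFieldTopology.Exports numFieldNormedType.Exports.

Local Open Scope classical_set_scope.
Local Open Scope ring_scope.

(** * Measurable minima over the naturals and diagonal extraction *)

Section nat_valued.
Context d (T : measurableType d).

Lemma measurable_fun_natP (f : T -> nat) :
  measurable_fun setT f <-> forall j, measurable [set w | f w = j].
Proof.
split=> [mf j|mf _ B _]; rewrite ?setTI.
  by have := mf measurableT [set j] I; rewrite setTI.
rewrite (_ : _ @^-1` _ = \bigcup_(j in B) [set w | f w = j]).
  by apply: bigcup_measurable => j _; exact: mf.
by apply/seteqP; split=> w /= => [Bw|[j Bj ->//]]; exists (f w).
Qed.

Lemma measurable_eval_nat dV (V : measurableType dV) (n : T -> nat)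
    (u : nat -> T -> V) :
  measurable_fun setT n -> (forall j, measurable_fun setT (u j)) ->
  measurable_fun setT (fun w => u (n w) w).
Proof.
move=> /measurable_fun_natP mn mu _ B mB; rewrite setTI.
rewrite (_ : _ @^-1` _ = \bigcup_j ([set w | n w = j] `&` u j @^-1` B)).
  apply: bigcupT_measurable => j; apply: measurableI => //.
  by rewrite -[X in measurable X]setTI; exact: mu.
apply/seteqP; split=> w /= => [Bw|[j _ [<-//]]].
by exists (n w).
Qed.

Lemma measurable_lim_sup_set (E : nat -> set T) :
  (forall n, measurable (E n)) -> measurable (lim_sup_set E).
Proof.
move=> mE; apply: bigcapT_measurable => n.
by apply: bigcup_measurable => k _; exact: mE.
Qed.

(** The default 0 makes the function total; it matters only where no [Q j] holds. *)
Definition least (Q : nat -> set T) (w : T) : nat :=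
  xget 0%N [set j | Q j w /\ forall i, (i < j)%N -> ~ Q i w].

Lemma leastP (Q : nat -> set T) w : (exists j, Q j w) ->
  Q (least Q w) w /\ forall i, (i < least Q w)%N -> ~ Q i w.
Proof.
move=> [j Qj]; rewrite /least; case: xgetP => [i _ []//|none]; exfalso.
have ex : exists i, `[< Q i w >] by exists j; exact/asboolP.
case: (ex_minnP ex) => i /asboolP Qi iP; apply: (none i); split=> // k ki Qk.
by move: ki; rewrite ltnNge iP//; exact/asboolP.
Qed.

(** As the default never occurs, the level set at [j] is [Q j] minus the finitely many earlier
    [Q i]. *)
Lemma measurable_least (Q : nat -> set T) :
  (forall j, measurable (Q j)) -> (forall w, exists j, Q j w) ->
  measurable_fun setT (least Q).
Proof.
move=> mQ exQ; apply/measurable_fun_natP => j.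
rewrite (_ : [set w | _] =
    Q j `&` \bigcap_(i in [set i | (i < j)%N]) ~` Q i).
  apply: measurableI => //; apply: bigcap_measurableType => i _.
  exact: measurableC.
apply/seteqP; split=> w /= => [<-|[Qj jP]]; first exact/leastP.
have [Ql lP] := leastP (exQ w).
by case: (ltngtP (least Q w) j) => // [/jP//|/lP].
Qed.

(* The branch of the tree of codes in which every node [m] is the least code
   taken infinitely often along the indices compatible with nodes [< m]. *)
Fixpoint branch (a : nat -> nat -> T -> nat) (m : nat) : nat -> set T :=
  if m is m'.+1 then
    let io c := lim_sup_set
      (fun n => branch a m' n `&` [set w | a m' n w = c]) in
    fun n => branch a m' n `&` [set w | a m' n w = least io w]
  else fun=> setT.

Definition node (a : nat -> nat -> T -> nat) (m : nat) : T -> nat :=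
  least (fun c =>
    lim_sup_set (fun n => branch a m n `&` [set w | a m n w = c])).

Lemma branchS a m n :
  branch a m.+1 n = branch a m n `&` [set w | a m n w = node a m w].
Proof. by []. Qed.

(** Branch 0 contains every index, so the diagonal may start at 0. *)
Fixpoint diag_index (a : nat -> nat -> T -> nat) (k : nat) : T -> nat :=
  if k is k'.+1 then
    least (fun n => branch a k n `&` [set w | (diag_index a k' w < n)%N])
  else cst 0%N.

Section diagonal.
Variable a : nat -> nat -> T -> nat.
Hypothesis a_measurable : forall m n, measurable_fun setT (a m n).
Hypothesis a_bounded : forall m w, exists N, forall n, (a m n w <= N)%N.

(** Pigeonhole at each [w]: an infinite branch carrying finitely many codes repeats one of them
    infinitely often, and the next branch keeps the least such code. *)
Lemma branch_io m : lim_sup_set (branch a m) = setT.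
Proof.
rewrite -subTset => w _; elim: m => [|m IH] N _; first by exists N => /=.
have [c ioc] : exists c,
    lim_sup_set (fun n => branch a m n `&` [set w | a m n w = c]) w.
  apply: contrapT => /forallNP no; have [B aB] := a_bounded m w.
  have {}no c : exists L, forall n,
      (L <= n)%N -> branch a m n w -> a m n w <> c.
    apply: contrapT => /forallNP noL; apply: (no c) => L _.
    apply: contrapT => noj; apply: (noL L) => n Ln bn ac.
    by apply: noj; exists n.
  have [L LP] := choice no.
  (* Past this maximum no code up to [B] occurs on the branch, yet the branch still has an index
     there. *)
  have [n /= Ln bn] := IH (\max_(c < B.+1) L c)%N I.
  have aB' : (a m n w < B.+1)%N by rewrite ltnS.
  apply: (LP (a m n w) n _ bn erefl); apply: leq_trans Ln.
  exact: (leq_bigmax (Ordinal aB')).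
have [io _] := @leastP (fun c => lim_sup_set
  (fun n => branch a m n `&` [set w | a m n w = c])) w (ex_intro _ c ioc).
by have [n Nn [bn an]] := io N I; exists n.
Qed.

Lemma node_exists m w : exists c,
  lim_sup_set (fun n => branch a m n `&` [set w | a m n w = c]) w.
Proof.
exists (node a m w) => N _.
have : lim_sup_set (branch a m.+1) w by rewrite branch_io.
by move=> /(_ N I)[n Nn]; rewrite branchS => ?; exists n.
Qed.

(** Induction on the level: measurable branches make the node a measurable minimum, which in turn
    cuts out the next branch. *)
Lemma measurable_branch m n : measurable (branch a m n).
Proof.
elim: m n => [|m IH] n; first exact: measurableT.
have ma c k : measurable [set w | a m k w = c].
  by move: c; apply/measurable_fun_natP.
have mnode : measurable_fun setT (node a m).
  apply: measurable_least; last exact: node_exists.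
  by move=> c; apply: measurable_lim_sup_set => k; exact: measurableI.
rewrite branchS; apply: measurableI => //.
rewrite (_ : [set w | _] =
    \bigcup_c ([set w | a m n w = c] `&` [set w | node a m w = c])).
  apply: bigcupT_measurable => c; apply: measurableI => //.
  by move: c; apply/measurable_fun_natP.
by apply/seteqP; split=> w /= => [an|[c _ [-> ->]]//]; exists (node a m w).
Qed.

Lemma diag_index_exists k w :
  exists n, (branch a k.+1 n `&` [set w | (diag_index a k w < n)%N]) w.
Proof.
have : lim_sup_set (branch a k.+1) w by rewrite branch_io.
by move=> /(_ (diag_index a k w).+1 I)[n /= ? ?]; exists n; split.
Qed.

Lemma measurable_diag_index k : measurable_fun setT (diag_index a k).
Proof.
elim: k => [|k IH]; first exact: measurable_cst.
apply: measurable_least; last exact: diag_index_exists.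
move=> n; apply: measurableI; first exact: measurable_branch.
rewrite (_ : [set w | _] =
    \bigcup_(j in [set j | (j < n)%N]) [set w | diag_index a k w = j]).
  by apply: bigcup_measurable => j _; move: j; apply/measurable_fun_natP.
apply/seteqP; split=> [w kn|w [j jn e]]; last by rewrite -e in jn.
by exists (diag_index a k w).
Qed.

Lemma diag_indexS k w : branch a k.+1 (diag_index a k.+1 w) w /\
  (diag_index a k w < diag_index a k.+1 w)%N.
Proof.
pose Q n := branch a k.+1 n `&` [set w | (diag_index a k w < n)%N].
exact: (@leastP Q w (diag_index_exists k w)).1.
Qed.

Lemma diag_index_branch k w : branch a k (diag_index a k w) w.
Proof. by case: k => [//|k]; have [] := diag_indexS k w. Qed.

(** Branches are nested: any index in branch [k] lies in branch [m.+1], where code [m] is fixed. *)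
Lemma diag_index_node m k w : (m < k)%N ->
  a m (diag_index a k w) w = node a m w.
Proof.
move=> mk; have := diag_index_branch k w; rewrite -(subnK mk).
move: (k - m.+1)%N (diag_index _ _ _) => j n.
by elim: j => [|j IH]; [case|rewrite addSn branchS => -[/IH]].
Qed.

End diagonal.
End nat_valued.

(** * Pointwise convergence along measurable indices for bounded real functions *)

Section bounded_subsequence.
Context d (T : measurableType d) (R : realType) (I : countType).
Variables (u : I -> nat -> T -> R) (M : T -> R).
Hypothesis mu : forall i n, measurable_fun setT (u i n).
Hypothesis mM : measurable_fun setT M.
Hypothesis uM : forall i n w, `|u i n w| <= M w.

(* [m] encodes a coordinate [i] and a precision [l]; the code of the [n]-th
   term is its cell in a grid of mesh [1 / l.+1], shifted by [M] so as to be a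
   natural number. *)
Definition grid_code (m n : nat) (w : T) : nat :=
  if unpickle m is Some (i, l) then
    Num.trunc ((l : nat).+1%:R * (u i n w + M w)) else 0%N.

Let grid_arg_ge0 (l : nat) i n w : 0 <= l.+1%:R * (u i n w + M w).
Proof. by rewrite mulr_ge0// -lerBlDr sub0r lerNnormlW. Qed.

Lemma measurable_grid_code m n : measurable_fun setT (grid_code m n).
Proof.
rewrite /grid_code; case: (unpickle m : option (I * nat)) => [[i l]|];
  last exact: measurable_cst.
apply/measurable_fun_natP => j.
rewrite (_ : [set w | _] = (fun w => l.+1%:R * (u i n w + M w)) @^-1`
    `[j%:R, j.+1%:R[%classic).
  rewrite -[X in measurable X]setTI; apply: measurable_funM => //.
  by apply: measurable_funD.
apply/seteqP; split=> w /=; rewrite in_itv/= -truncn_eq//; first by move=> ->.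
by move/eqP.
Qed.

Lemma grid_code_bounded m w : exists N, forall n, (grid_code m n w <= N)%N.
Proof.
rewrite /grid_code; case: (unpickle m : option (I * nat)) => [[i l]|];
  last by exists 0%N.
exists (Num.trunc (l.+1%:R * (M w + M w))) => n.
apply: le_truncn; rewrite ler_pM2l// lerD2r.
by rewrite (le_trans (ler_norm _)).
Qed.

Lemma bounded_subseq : exists n_ : nat -> T -> nat,
  [/\ forall k, measurable_fun setT (n_ k),
      forall k w, (n_ k w < n_ k.+1 w)%N &
      forall i w, cvgn (fun k => u i (n_ k w) w)].
Proof.
exists (diag_index grid_code); split.
- move=> k; apply: measurable_diag_index.
    exact: measurable_grid_code.
  exact: grid_code_bounded.
- move=> k w; apply: (diag_indexS _ _ _).2.
  exact: grid_code_bounded.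
move=> i w; apply/cauchy_cvgP; apply/cauchy_exP => e e0.
have [l le] : exists l : nat, l.+1%:R^-1 < e.
  have [N _ NP] := near_infty_natSinv_lt (PosNum e0).
  by exists N; apply: (NP N) => /=.
pose m := pickle (i, l); pose n_ := diag_index grid_code.
have codeE n : grid_code m n w = Num.trunc (l.+1%:R * (u i n w + M w)).
  by rewrite /grid_code /m pickleK.
(* From step [m.+1] on code [m] is constant, so all later terms share a grid cell with this one,
   taken as centre of the ball. *)
exists (u i (n_ m.+1 w) w); exists m.+1 => // k /= mk.
have : grid_code m (n_ k w) w = grid_code m (n_ m.+1 w) w.
  by rewrite !diag_index_node//; exact: grid_code_bounded.
rewrite !codeE.
set x := u i _ w; set y := u i _ w => xy.
(* Both rescaled values lie in the same interval from [c] to [c + 1]; the shift [M w] cancels in the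
   difference, which is thus below the mesh. *)
have := truncn_itv (grid_arg_ge0 l i (n_ k w) w).
have := truncn_itv (grid_arg_ge0 l i (n_ m.+1 w) w).
rewrite -/x -/y xy; set c := Num.trunc _.
have l0 : 0 < l.+1%:R :> R by [].
rewrite -ball_normE /= => /andP[cy yc] /andP[cx xc].
apply: lt_trans le; rewrite -[ltRHS]mul1r ltr_pdivlMr//.
rewrite mulrC -[l.+1%:R]gtr0_norm// -normrM ltr_norml.
move: yc xc; rewrite -natr1 => yc xc; apply/andP; split; lra.
Qed.

End bounded_subsequence.

(** * Subsequences and coordinatewise convergence *)

Lemma increasing_ge (n_ : nat -> nat) : (forall k, (n_ k < n_ k.+1)%N) ->
  forall k, (k <= n_ k)%N.
Proof. by move=> n_S; elim=> // k /leq_ltn_trans; exact. Qed.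

Lemma cvg_subseq (U : topologicalType) (u : nat -> U) (l : U)
    (n_ : nat -> nat) :
  (forall k, (n_ k < n_ k.+1)%N) -> u @ \oo --> l ->
  (fun k => u (n_ k)) @ \oo --> l.
Proof.
move=> /increasing_ge n_ge; apply: cvg_comp => A [N _ NA].
by exists N => // k /= Nk; apply: NA; exact: leq_trans Nk (n_ge k).
Qed.

Lemma ler_norm_euclid_dist (R : realType) (dim : nat) (x y : dim.-tuple R)
    (i : 'I_dim) :
  `|tnth x i - tnth y i| <= euclid_dist x y.
Proof.
rewrite -sqrtr_sqr ler_wsqrtr// (bigD1 i)//= lerDl.
by apply: sumr_ge0 => j _; exact: sqr_ge0.
Qed.

Lemma cvg_euclid_dist (R : realType) (dim : nat) (x : nat -> dim.-tuple R)
    (y : dim.-tuple R) :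
  (forall i, (fun k => tnth (x k) i) @ \oo --> tnth y i) ->
  (fun k => euclid_dist y (x k)) @ \oo --> (0 : R).
Proof.
move=> xy.
have s0 (r : seq 'I_dim) :
    (fun k => \sum_(i <- r) (tnth y i - tnth (x k) i) ^+ 2) @ \oo --> (0 : R).
  elim: r => [|i r IH].
    by under eq_fun do rewrite big_nil; exact: cvg_cst.
  rewrite -[X in _ --> X](addr0 (0 : R)); under eq_fun do rewrite big_cons.
  apply: cvgD => //; rewrite -[X in _ --> X](mulr0 (0 : R)) -(subrr (tnth y i)).
  under eq_fun do rewrite expr2.
  by apply: cvgM; apply: cvgB => //; exact: cvg_cst.
rewrite -[X in _ --> X](@sqrtr0 R).
exact: (continuous_cvg _ (@sqrt_continuous R 0) (s0 _)).
Qed.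

(** * Random indices in conditional metric spaces *)

Section random_index.
Context disp (Omega : measurableType disp) (R : realType).
Variables (P : probability Omega R) (G : subSigmaAlgebra Omega).
Implicit Type X : condMetricSpace P G.

(** Where [n] equals [j] the concatenation has distance 0 to [x_ j], so two triangle inequalities
    give equality; countably many null sets are then discarded. *)
Lemma cdist_rand_index X (x : X) (x_ : nat -> X) (n : L0 P G nat) :
  \forall w \ae P, cdist x (rand_index x_ n) w = cdist x (x_ (n w)) w.
Proof.
pose y := rand_index x_ n.
have yx j : \forall w \ae P,
    n w = j -> cdist x y w = cdist x (x_ j) w.
  apply: filterS3 (filterI (concatP (levels n) x_ j) (cdist_sym y (x_ j)))
    (cdist_triangle x y (x_ j)) (cdist_triangle x (x_ j) y).
  move=> w [+ sym] t1 t2 nj; rewrite indicE mem_set// mul1r => y0.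
  move: t1 t2; rewrite -sym -/y y0 !addr0 => t1 t2.
  by apply/eqP; rewrite eq_le t1 t2.
by apply: filterS (ae_foralln yx) => w; exact.
Qed.

Lemma cvg_as_rand_index X (x : X) (x_ : nat -> X) (n_ : nat -> L0 P G nat) :
  rand_increasing n_ -> cvg_as x_ x ->
  cvg_as (fun k => rand_index x_ (n_ k)) x.
Proof.
move=> n_S x_x.
apply: filterS3 (ae_foralln n_S) x_x
  (ae_foralln (fun k => cdist_rand_index x x_ (n_ k))) => w nS xw xn.
by under eq_fun do rewrite xn; exact: (cvg_subseq nS xw).
Qed.

End random_index.

(** * Conditional Bolzano-Weierstrass theorem for random vectors *)

Section conditional_Bolzano_Weierstrass.
Context disp (Omega : measurableType disp) (R : realType).
Variables (P : probability Omega R) (G : subSigmaAlgebra Omega) (dim : nat).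

Lemma cdist_L0vecE (z z' : L0vec P G dim) : \forall w \ae P,
  cdist z z' w = euclid_dist ((z : L0 P G _) w) ((z' : L0 P G _) w).
Proof. exact: vec_distE. Qed.

Lemma L0vec_bounded_subseq (z_ : nat -> L0vec P G dim) (M : L0 P G R) :
  (forall n, \forall w \ae P, cdist (z_ n) (vec0 P G dim) w <= M w) ->
  exists (n_ : nat -> L0 P G nat) (z : L0vec P G dim),
    rand_increasing n_ /\ cvg_as (fun k => rand_index z_ (n_ k)) z.
Proof.
move=> zM.
(* Clamping to [-|M|, |M|] changes the sequence on a null set only and makes
   it bounded everywhere. *)
pose u (i : 'I_dim) n (w : g_sigma_algebraType G) : R :=
  Num.max (- `|M w|) (Num.min `|M w| (tnth ((z_ n : L0 P G _) w) i)).
have mM : measurable_fun setT ((fun w => `|M w|) : g_sigma_algebraType G -> R).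
  exact: (measurableT_comp (@normr_measurable R setT)
    (@L0_measurable _ _ _ _ _ _ _ M)).
have mu i n : measurable_fun setT (u i n).
  apply: measurable_maxr.
    exact: (measurableT_comp (@oppr_measurable R setT)).
  apply: measurable_minr => //.
  apply: (measurableT_comp (measurable_tnth i)); exact: L0_measurable.
have uM i n w : `|u i n w| <= `|M w|.
  rewrite ler_norml /u le_max lexx /= ge_max ge_min lexx /= andbT.
  by rewrite (le_trans _ (normr_ge0 _))// oppr_le0.
have [n_ [mn nS cvgu]] := bounded_subseq mu mM uM.
(* The clamped subsequence converges at every [w], so the limit is measurable without exceptional
   sets. *)
pose l i w := limn (fun k => u i (n_ k w) w).
pose f w := [tuple l i w | i < dim].
have mf : measurable_fun setT (f : g_sigma_algebraType G -> dim.-tuple R).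
  apply/measurable_fun_tnthP => i.
  apply: (@measurable_fun_cvg _ _ _ _ (fun k w => u i (n_ k w) w)).
    by move=> k; exact: measurable_eval_nat.
  by move=> w _; rewrite /= tnth_mktuple; exact: cvgu.
exists (fun k => mkL0 P (mn k)), (mkL0 P mf); split.
  move=> k; apply: filterS2 (mkL0E P (mn k)) (mkL0E P (mn k.+1)) => w -> ->.
  exact: nS.
(* Almost surely the clamp is inactive: each coordinate is dominated by the distance to 0, hence by
   [M]. *)
have zu : \forall w \ae P, forall n i, tnth ((z_ n : L0 P G _) w) i = u i n w.
  have vec0E : \forall w \ae P,
      (vec0 P G dim : L0 P G _) w = [tuple 0 | _ < dim].
    exact: mkL0E.
  apply: ae_foralln => n.
  apply: filterS3 (zM n) (cdist_L0vecE (z_ n) (vec0 P G dim)) vec0E => w.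
  move=> zMw dE z0 i.
  rewrite dE in zMw; have := le_trans (ler_norm_euclid_dist _ _ i) zMw.
  rewrite z0 tnth_mktuple subr0 => zi.
  have : `|tnth ((z_ n : L0 P G _) w) i| <= `|M w|.
    exact: le_trans zi (ler_norm _).
  by rewrite ler_norml /u => /andP[? ?]; rewrite min_r// max_r.
apply: filterS3 (filterI zu (mkL0E P mf))
  (ae_foralln (fun k => cdist_rand_index (mkL0 P mf : L0vec P G dim) z_
    (mkL0 P (mn k))))
  (filterI (ae_foralln (fun j => cdist_L0vecE (mkL0 P mf) (z_ j)))
    (ae_foralln (fun k => mkL0E P (mn k)))) => w [zuw fw] dk [dj nk].
under eq_fun do rewrite dk dj nk fw.
apply: cvg_euclid_dist => i; rewrite tnth_mktuple.
by under eq_fun do rewrite zuw; exact: cvgu.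
Qed.

End conditional_Bolzano_Weierstrass.

(** * From closed graph and local boundedness to (c3) and (c4) *)

Section closed_bounded_correspondence.
Context disp (Omega : measurableType disp) (R : realType).
Variables (P : probability Omega R) (G : subSigmaAlgebra Omega) (dim : nat).
Variables (X : condMetricSpace P G) (Theta : X -> set (L0vec P G dim)).
Hypotheses (Theta_c2 : cond_c2 Theta) (Theta_closed : closed_graph Theta).
Hypothesis Theta_bounded : locally_bounded Theta.

Lemma closed_bounded_subseq (x_ : nat -> X) (x : X)
    (z_ : nat -> L0vec P G dim) :
  cvg_as x_ x -> (forall n, Theta (x_ n) (z_ n)) ->
  exists (n_ : nat -> L0 P G nat) (z : L0vec P G dim),
    [/\ rand_increasing n_, Theta x z &
        cvg_as (fun k => rand_index z_ (n_ k)) z].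
Proof.
move=> x_x Tz; have [M _ MP] := Theta_bounded x_x.
have [n_ [z [nS z_z]]] : exists (n_ : nat -> L0 P G nat) (z : L0vec P G dim),
    rand_increasing n_ /\ cvg_as (fun k => rand_index z_ (n_ k)) z.
  by apply: (@L0vec_bounded_subseq _ _ _ _ _ _ _ M) => n; apply: MP; exists n.
exists n_, z; split=> //.
pose u_ k : prod_cms X (L0vec P G dim) :=
  (rand_index x_ (n_ k), rand_index z_ (n_ k)).
apply: (Theta_closed (x_ := u_) (x := (x, z))) => [k|] /=.
  (* Both random terms are concatenated over the same level sets of [n_ k], so (c2) puts the pair in
     the graph. *)
  by rewrite /rand_index Theta_c2; exists z_.
apply: filterS3 (ae_foralln (fun k => prod_distE (x, z) (u_ k)))
  (cvg_as_rand_index nS x_x) z_z => w dE xw zw.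
apply/cvgrPdist_lt => e e0.
move/cvgrPdist_lt : xw => /(_ _ e0) xw; move/cvgrPdist_lt : zw => /(_ _ e0) zw.
apply: filterS2 xw zw => k xk zk; rewrite [cdist _ _ _]dE maxEle.
by case: ifP => _; [exact: zk|exact: xk].
Qed.

Lemma closed_bounded_c3 : cond_c3 Theta.
Proof.
move=> x z_ Tz; apply: (@closed_bounded_subseq (cst x)) => //.
(* The distance from [x] to itself is 0 only almost surely, so the constant sequence converges off a
   null set. *)
have /cdist_eq0 xx : x = x by [].
apply: filterS xx => w xw; under eq_fun do rewrite xw; exact: cvg_cst.
Qed.

Lemma closed_bounded_c4 : cond_c4 Theta.
Proof.
move=> x_ x z_ x_x Tz.
have [n_ [z [nS Txz z_z]]] := closed_bounded_subseq x_x Tz.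
exists n_, (cst z); split=> //.
apply: filterS2 z_z (ae_foralln (fun k => cdist_sym (rand_index z_ (n_ k)) z)).
by move=> w zw sym; under eq_fun do rewrite sym.
Qed.

End closed_bounded_correspondence.

Theorem proposition3p1 (disp : measure_display) (Omega : measurableType disp)
    (R : realType) (P : probability Omega R)
    (T : nat) (F : nat -> subSigmaAlgebra Omega)
    (F_le : forall t : nat, (t < T)%N ->
      (ssa_sets (F t) `<=` ssa_sets (F t.+1))%classic)
    (F_T : ssa_sets (F T) = measurable)
    (dim : nat) (dim_gt0 : (0 < dim)%N)
    (X : forall t : 'I_T, condMetricSpace P (F t))
    (Theta : forall t : 'I_T, X t -> set (L0vec P (F t) dim))
    (Theta_c1 : forall t : 'I_T, cond_c1 (Theta t))
    (Theta_c2 : forall t : 'I_T, cond_c2 (Theta t))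
    (Theta_i : forall t : 'I_T, closed_graph (Theta t))
    (Theta_ii : forall t : 'I_T, locally_bounded (Theta t)) :
  forall t : 'I_T,
    [/\ cond_c1 (Theta t), cond_c2 (Theta t),
        cond_c3 (Theta t) & cond_c4 (Theta t)].
Proof.
move=> t; split; [exact: Theta_c1|exact: Theta_c2| |].
  by apply: closed_bounded_c3; [exact: Theta_c2|exact: Theta_i|exact: Theta_ii].
by apply: closed_bounded_c4; [exact: Theta_c2|exact: Theta_i|exact: Theta_ii].
Qed.
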